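(* Let $N>1$ be an integer, let $a_1,\dots,a_N$ be non-negative integers, let $m_1,\dots,m_N$ be positive integers, and let $c_1,\dots,c_N$ be positive real numbers. Then the limit $$\lim_{(x_1,\dots,x_N)\to(0,\dots,0)} \frac{x_1^{a_1}\cdots x_N^{a_N}}{c_1x_1^{2m_1}+\cdots+c_Nx_N^{2m_N}}$$ exists if and only if $$\sum_{i=1}^{N}\frac{a_i}{2m_i}>1.$$ Moreover, when the limit exists, it is equal to zero.
   Context: The variables $x_1,\dots,x_N$ are real, and the rational function is regarded as a real-valued function on $\mathbb{R}^N\setminus\{(0,\dots,0)\}$ (its denominator vanishes only at the origin). The limit is the usual multivariable limit as $(x_1,\dots,x_N)$ tends to the origin through points of $\mathbb{R}^N\setminus\{(0,\dots,0)\}$; ''the limit exists'' means that it exists as a finite real number (divergence to $\pm\infty$ counts as non-existence). The convention $x^0=1$ is used for all real $x$, including $x=0$. *)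

(* Defs.v *)
From mathcomp Require Import all_boot all_order all_algebra.
From mathcomp Require Import all_classical all_reals all_analysis.

Set Implicit Arguments.
Unset Strict Implicit.
Unset Printing Implicit Defensive.

Import GRing.Theory Num.Theory numFieldNormedType.Exports.

Local Open Scope ring_scope.

(* The denominator vanishes only at x = 0 (for c > 0 and m > 0), so the value
   given there by the convention y / 0 = 0 is irrelevant to a limit along the
   punctured neighborhoods of 0. *)
Definition monomial_quotient (R : realType) (N : nat) (a m : 'I_N -> nat)
    (c : 'I_N -> R) (x : 'rV[R]_N) : R :=
  (\prod_(i < N) x ord0 i ^+ a i) /
  (\sum_(i < N) c i * x ord0 i ^+ (2 * m i)).

(* Main.v *)
(* Choose integer weights w_i with w_i * 2m_i = L for all i, so that the
   condition becomes P > L with P = sum_i a_i w_i. Write D for the denominator.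
   Since c_i x_i^(2m_i) <= D, the L-th power of the quotient is bounded by
   C D^(P - L), which tends to 0 when P > L.
   Conversely, along x_i = t^(w_i) u_i the quotient equals t^(P - L) Q(u), so if
   P <= L and the limit l exists then 0^(L - P) l = Q(u) for every u <> 0. But
   Q(1, ..., 1) <> 0, which forces P = L > 0; then some a_k > 0, and the vector
   u with u_k = 0 and all other entries 1, nonzero because N > 1, gives
   Q(u) = 0, a contradiction. *)
Require Import Defs.
From mathcomp Require Import all_boot all_order all_algebra.
From mathcomp Require Import all_classical all_reals all_analysis.

Set Implicit Arguments.
Unset Strict Implicit.
Unset Printing Implicit Defensive.

Import Order.TTheory GRing.Theory Num.Theory numFieldNormedType.Exports.

Local Open Scope classical_set_scope.
Local Open Scope ring_scope.

Definition diag_form {R : realType} {N : nat} (m : 'I_N -> nat) (c : 'I_N -> R)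
    (x : 'rV[R]_N) : R :=
  \sum_(i < N) c i * x ord0 i ^+ (2 * m i).

Lemma even_pow_ge0 {R : realType} (y : R) (k : nat) : 0 <= y ^+ (2 * k).
Proof. by rewrite exprM exprn_ge0 // sqr_ge0. Qed.

Lemma diag_form_term_le {R : realType} {N : nat} (m : 'I_N -> nat)
    (c : 'I_N -> R) (hc : forall i, 0 < c i) (x : 'rV[R]_N) (i : 'I_N) :
  c i * x ord0 i ^+ (2 * m i) <= diag_form m c x.
Proof.
rewrite /diag_form (bigD1 i) //= lerDl sumr_ge0 // => j _.
by rewrite mulr_ge0 ?even_pow_ge0 // ltW.
Qed.

Lemma diag_form_gt0 {R : realType} {N : nat} (m : 'I_N -> nat)
    (c : 'I_N -> R) (hc : forall i, 0 < c i) (x : 'rV[R]_N) :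
  x != 0 -> 0 < diag_form m c x.
Proof.
move=> /rV0Pn[i xi0]; apply: lt_le_trans (diag_form_term_le m hc x i).
by rewrite mulr_gt0 // lt_def even_pow_ge0 expf_neq0.
Qed.

Lemma diag_form_cvg0 {R : realType} {N : nat} (m : 'I_N -> nat)
    (hm : forall i, (0 < m i)%N) (c : 'I_N -> R) :
  diag_form m c x @[x --> (0 : 'rV[R]_N)^'] --> (0 : R).
Proof.
(* Once 0 is written as the value of the form at the origin, the limit is continuity; [hm] makes
   each power of 0 vanish. *)
have -> : (0 : R) = \sum_(i < N) c i * (0 : 'rV[R]_N) ord0 i ^+ (2 * m i).
  by rewrite big1 // => i _; rewrite mxE expr0n muln_eq0 /= eqn0Ngt hm mulr0.
apply: cvg_within_filter; apply: cvg_big => [|i _]; first exact: add_continuous.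
apply: cvgM; first exact: cvg_cst.
apply: (continuous_cvg _ (@exprn_continuous R (2 * m i) _)).
exact: coord_continuous.
Qed.

(** The [L]-th power of [|x_i^(a_i)|] is [(x_i^(2 m_i))^(a_i w_i)], at most [(D / c_i)^(a_i w_i)]
    for [D] the form; multiply over [i]. Raising to the power [L] avoids fractional exponents. *)
Lemma monomial_pow_le {R : realType} {N L : nat} (a m w : 'I_N -> nat)
    (hw : forall i, (w i * (2 * m i))%N = L)
    (c : 'I_N -> R) (hc : forall i, 0 < c i) (x : 'rV[R]_N) :
  `|\prod_(i < N) x ord0 i ^+ a i| ^+ L <=
    (\prod_(i < N) (c i)^-1 ^+ (a i * w i)) *
    diag_form m c x ^+ (\sum_(i < N) a i * w i).
Proof.
rewrite normr_prod -prodrXl -prodrXr -big_split /=.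
apply: ler_prod => i _; rewrite exprn_ge0 //= -exprMn -(hw i).
have -> : `|x ord0 i ^+ a i| ^+ (w i * (2 * m i)) =
          (x ord0 i ^+ (2 * m i)) ^+ (a i * w i).
  rewrite -[x ord0 i ^+ (2 * m i)]ger0_norm ?even_pow_ge0 // !normrX -!exprM.
  by congr (_ ^+ _); rewrite mulnA mulnC.
have D0 : 0 <= diag_form m c x.
  exact: le_trans (mulr_ge0 (ltW (hc i)) (even_pow_ge0 _ _))
                  (diag_form_term_le m hc x i).
apply: lerXn2r; rewrite ?nnegrE ?even_pow_ge0 ?mulr_ge0 ?invr_ge0 ?(ltW (hc i)) //.
by rewrite mulrC ler_pdivlMr // mulrC diag_form_term_le.
Qed.

Lemma monomial_quotient_cvg0 {R : realType} {N L : nat} (a m w : 'I_N -> nat)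
    (hm : forall i, (0 < m i)%N) (hL : (0 < L)%N)
    (hw : forall i, (w i * (2 * m i))%N = L)
    (c : 'I_N -> R) (hc : forall i, 0 < c i) :
  (L < \sum_(i < N) a i * w i)%N ->
  monomial_quotient a m c x @[x --> (0 : 'rV[R]_N)^'] --> (0 : R).
Proof.
set P := (\sum_(i < N) _)%N => ltLP.
set C := \prod_(i < N) (c i)^-1 ^+ (a i * w i).
have bound_cvg :
    C * diag_form m c x ^+ (P - L) @[x --> (0 : 'rV[R]_N)^'] --> (0 : R).
  have -> : (0 : R) = C * 0 ^+ (P - L).
    by rewrite expr0n subn_eq0 leqNgt ltLP mulr0.
  apply: cvgM; first exact: cvg_cst.
  apply: (continuous_cvg _ (@exprn_continuous R (P - L) _)).
  exact: diag_form_cvg0.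
apply/cvgr0Pnorm_lt => e e0.
have eL0 : 0 < e ^+ L by rewrite exprn_gt0.
near=> x.
have x0 : x != 0 by near: x; exact: nbhs_dnbhs_neq.
have lt_e : `|C * diag_form m c x ^+ (P - L)| < e ^+ L.
  by near: x; exact: cvgr0_norm_lt.
rewrite -(@ltr_pXn2r _ L) ?nnegrE ?(ltW e0) //.
apply: le_lt_trans lt_e; apply: le_trans (ler_norm _).
have D0 := diag_form_gt0 m hc x0.
rewrite normrM normfV exprMn exprVn (gtr0_norm D0).
(* Clearing the denominator [D ^+ L] turns [D ^+ (P - L)] into [D ^+ P], because [L < P]. *)
rewrite ler_pdivrMr ?exprn_gt0 // -mulrA -exprD subnK ?(ltnW ltLP) //.
exact: monomial_pow_le.
Unshelve. all: by end_near.
Qed.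

(* The orbit of [u] under the weighted dilations for which the denominator is
   homogeneous. *)
Definition weighted_curve {R : realType} {N : nat} (w : 'I_N -> nat)
    (u : 'rV[R]_N) (t : R) : 'rV[R]_N :=
  \row_i (t ^+ w i * u ord0 i).

(** Positive weights send the curve to 0. It avoids 0 because a nonzero coordinate of [u] stays
    nonzero for [t > 0]. *)
Lemma weighted_curve_cvg {R : realType} {N : nat} (w : 'I_N -> nat)
    (hw : forall i, (0 < w i)%N) (u : 'rV[R]_N) :
  u != 0 -> weighted_curve w u t @[t --> (0 : R)^'+] --> (0 : 'rV[R]_N)^'.
Proof.
move=> /rV0Pn[k uk0].
have curve_cvg : weighted_curve w u t @[t --> (0 : R)^'+] --> (0 : 'rV[R]_N).
  apply/cvg_ballP => e e0.
  have : \forall t \near (0 : R)^'+, forall i, `|t ^+ w i * u ord0 i| < e.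
    apply: filter_forall => i; apply: cvgr0_norm_lt => //.
    have at0 : 0 ^+ w i * u ord0 i = 0 by rewrite expr0n eqn0Ngt hw mul0r.
    rewrite -[X in _ --> X]at0; apply: cvgM; last exact: cvg_cst.
    exact: (cvg_at_right_filter (@exprn_continuous R (w i) 0)).
  apply: filterS => t ht; split => // i j.
  by rewrite !mxE /ball /= sub0r normrN.
move=> A /curve_cvg; apply: filterS2 (nbhs_right_gt 0) => t t0; apply.
by apply/rV0Pn; exists k; rewrite mxE mulf_neq0 // expf_neq0 // gt_eqF.
Qed.

(** Every punctured neighborhood of 0 meets the line through [(1, ..., 1)]. Properness gives
    uniqueness of limits, hence the value of [lim]. *)
Lemma dnbhs0_proper {R : realType} {N : nat} :
  (0 < N)%N -> ProperFilter (0 : 'rV[R]_N)^'.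
Proof.
move=> N0; apply: Build_ProperFilter => E.
have u0 : (const_mx 1 : 'rV[R]_N) != 0.
  by apply/rV0Pn; exists (Ordinal N0); rewrite mxE oner_neq0.
have /(_ _ E) := @weighted_curve_cvg R N (fun=> 1%N) (fun=> isT) _ u0.
exact: filter_not_empty.
Qed.

Lemma monomial_quotient_curve {R : realType} {N L : nat}
    (a m w : 'I_N -> nat) (hw : forall i, (w i * (2 * m i))%N = L)
    (c : 'I_N -> R) (u : 'rV[R]_N) (t : R) :
  monomial_quotient a m c (weighted_curve w u t) =
  t ^+ (\sum_(i < N) a i * w i) / t ^+ L * monomial_quotient a m c u.
Proof.
rewrite /monomial_quotient.
under eq_bigr do rewrite mxE exprMn -exprM mulnC.
rewrite big_split /= prodrXr.
under [X in _ / X]eq_bigr do rewrite mxE exprMn -exprM hw mulrCA.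
by rewrite -mulr_sumr invfM mulrACA.
Qed.

(** Multiplying by [t ^+ (L - P)] makes the quotient constant along the curve for [t > 0]. The
    factor [0 ^+ (L - P)] is 1 if [P = L] and 0 if [P < L], so one identity covers both cases. *)
Lemma cvg_along_weighted_curve {R : realType} {N L : nat}
    (a m w : 'I_N -> nat) (hL : (0 < L)%N)
    (hw : forall i, (w i * (2 * m i))%N = L)
    (c : 'I_N -> R) (l : R) (u : 'rV[R]_N) :
  (\sum_(i < N) a i * w i <= L)%N -> u != 0 ->
  monomial_quotient a m c x @[x --> (0 : 'rV[R]_N)^'] --> l ->
  0 ^+ (L - \sum_(i < N) a i * w i) * l = monomial_quotient a m c u.
Proof.
set P := (\sum_(i < N) _)%N => lePL u0 Ql.
have w0 i : (0 < w i)%N by move: hL; rewrite -(hw i) muln_gt0 => /andP[].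
have Qcurve := cvg_comp _ _ (weighted_curve_cvg w0 u0) Ql.
have : t ^+ (L - P) * monomial_quotient a m c (weighted_curve w u t)
    @[t --> (0 : R)^'+] --> 0 ^+ (L - P) * l.
  by apply: cvgM => //; exact: (cvg_at_right_filter (@exprn_continuous R _ 0)).
move=> /cvg_unique; apply => //; apply: cvg_near_cst.
apply: filterS (nbhs_right_gt 0) => t t0.
have tL0 : t ^+ L != 0 by rewrite expf_neq0 // gt_eqF.
by rewrite (monomial_quotient_curve a hw) !mulrA -exprD subnK // divff // mul1r.
Qed.

Lemma cvg_weighted_degree_gt {R : realType} {N L : nat} (hN : (1 < N)%N)
    (a m w : 'I_N -> nat) (hL : (0 < L)%N)
    (hw : forall i, (w i * (2 * m i))%N = L)
    (c : 'I_N -> R) (hc : forall i, 0 < c i) :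
  cvg (monomial_quotient a m c x @[x --> (0 : 'rV[R]_N)^']) ->
  (L < \sum_(i < N) a i * w i)%N.
Proof.
move=> /cvg_ex[l Ql]; rewrite ltnNge; apply/negP => lePL.
have along u u0 := cvg_along_weighted_curve hL hw lePL (u := u) u0 Ql.
pose one : 'rV[R]_N := const_mx 1.
have one0 : one != 0.
  by apply/rV0Pn; exists (Ordinal (ltnW hN)); rewrite mxE oner_neq0.
have Q1 : monomial_quotient a m c one != 0.
  rewrite mulf_neq0 ?invr_neq0 ?gt_eqF ?diag_form_gt0 //.
  by rewrite big1 ?oner_neq0 // => i _; rewrite mxE expr1n.
have l0 := along _ one0.
have [/forallP a0|/forallPn[k ak0]] := boolP [forall i, a i == 0%N].
  (* Here [P = 0], so [0 ^+ L * l = 0] would be the nonzero value at [one]. *)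
  move: Q1; rewrite -l0 big1 ?subn0 ?expr0n ?eqn0Ngt ?hL ?mul0r ?eqxx //.
  by move=> i _; rewrite (eqP (a0 i)).
have [j jk] : exists j : 'I_N, j != k.
  have : (0 < #|predC1 k|)%N by rewrite cardC1 card_ord -ltnS prednK // ltnW.
  by case/card_gt0P=> j; exists j.
pose u : 'rV[R]_N := \row_i (i != k)%:R.
have u0 : u != 0 by apply/rV0Pn; exists j; rewrite mxE jk oner_neq0.
(* The left side of [along] does not depend on the vector, so the values at [one] and [u] agree; the
   latter is 0 by its factor [0 ^+ a k]. *)
move: Q1; rewrite -l0 (along _ u0) /monomial_quotient (bigD1 k) //= mxE eqxx.
by rewrite expr0n (negPf ak0) !mul0r eqxx.
Qed.

Lemma common_weights {N : nat} (m : 'I_N -> nat) (hm : forall i, (0 < m i)%N) :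
  exists L (w : 'I_N -> nat),
    (0 < L)%N /\ forall i, (w i * (2 * m i))%N = L.
Proof.
(* Any positive common multiple of the [2 * m i] would serve. *)
exists (\prod_(i < N) (2 * m i))%N.
exists (fun i => (\prod_(j < N) (2 * m j)) %/ (2 * m i))%N; split.
  by rewrite prodn_gt0 // => i; rewrite muln_gt0 hm.
by move=> i; rewrite divnK // (bigD1 i) //= dvdn_mulr.
Qed.

(** Multiply by [L]: each [a_i / (2 m_i)] becomes [a_i w_i]. *)
Lemma weighted_degree_gt {R : realType} {N L : nat} (a m w : 'I_N -> nat)
    (hL : (0 < L)%N) (hw : forall i, (w i * (2 * m i))%N = L) :
  (1 < \sum_(i < N) (a i)%:R / (2 * m i)%:R :> R) =
  (L < \sum_(i < N) a i * w i)%N.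
Proof.
have L0 : 0 < L%:R :> R by rewrite ltr0n.
rewrite -(ltr_pM2r L0) mul1r mulr_suml -(ltr_nat R) natr_sum.
congr (_ < _); apply: eq_bigr => i _.
have : (2 * m i)%:R != 0 :> R.
  by rewrite pnatr_eq0; apply: contraTneq hL => m0; rewrite -(hw i) m0 muln0.
by move=> mi0; rewrite -(hw i) (mulnC (w i)) (natrM _ (2 * m i)) mulrA divfK // natrM.
Qed.

Theorem mainTheorem1 (R : realType) (N : nat) (hN : (1 < N)%N)
    (a m : 'I_N -> nat) (c : 'I_N -> R)
    (hm : forall i : 'I_N, (0 < m i)%N) (hc : forall i : 'I_N, 0 < c i) :
  (cvg (monomial_quotient a m c x @[x --> (0 : 'rV[R]_N)^']) <->
     1 < \sum_(i < N) (a i)%:R / (2 * m i)%:R :> R) /\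
  (cvg (monomial_quotient a m c x @[x --> (0 : 'rV[R]_N)^']) ->
     lim (monomial_quotient a m c x @[x --> (0 : 'rV[R]_N)^']) = 0).
Proof.
have [L [w [hL hw]]] := common_weights hm.
rewrite (weighted_degree_gt a hL hw).
have necessary := cvg_weighted_degree_gt hN hL hw hc.
have sufficient := monomial_quotient_cvg0 (a := a) hm hL hw hc.
split; first by split=> [|/sufficient]; [exact: necessary | exact: cvgP].
move=> /necessary/sufficient Q0.
by have := dnbhs0_proper (ltnW hN) => ?; apply: cvg_lim.
Qed.
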